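(* Let $\Phi$ be a commutative integral domain, let $D=Ass[X,Y]$ be the free associative $\Phi$-algebra on two generators $X,Y$, with the standard involution $*$, and let $J=H(D,* )=\{a\in D\mid a^*=a\}$, regarded as a Jordan algebra. Then $J$ is strongly nonsingular, and its maximal algebra of quotients $Q_{max}(J)$ is not von Neumann regular.
   Context: ''Jordan algebra'' means a quadratic Jordan algebra $J$ (not necessarily unital) over a unital commutative ring $\Phi$, with products $U_xy$ and $x^2$ and linearizations $U_{x,z}y=V_{x,y}z=\{x,y,z\}=U_{x+z}y-U_xy-U_zy$, $x\circ y=V_xy=(x+y)^2-x^2-y^2$. $\widehat J=\Phi 1\oplus J$ is its free unital hull. An associative algebra $D$ with involution $*$ gives the Jordan algebra $H(D,* )$ with $U_xy=xyx$ and $x^2=xx$. The standard involution on $Ass[X,Y]$ is the $\Phi$-linear involution fixing $X$ and $Y$ (reversing words). An inner ideal of $J$ is a $\Phi$-submodule $K$ with $U_k\widehat J\subseteq K$ for all $k\in K$; it is essential if it has nonzero intersection with every nonzero inner ideal of $J$. $J$ is nondegenerate if $U_xJ\neq 0$ for every nonzero $x\in J$. $J$ is strongly nonsingular if for every essential inner ideal $K$ of $J$ and every $a\in J$, $U_aK=0$ implies $a=0$. $J$ is von Neumann regular if for every $a\in J$ there is $y\in J$ with $U_ay=a$. Maximal algebra of quotients: for an inner ideal $K$ of $J$ and $a\in J$ set $(K:a)=\{x\in K\mid U_ax,\ x\circ a\in K\}$, and inductively $(K:a_1:\ldots:a_n)=((K:a_1:\ldots:a_{n-1}):a_n)$. $K$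 is dense if $U_c(K:a_1:\ldots:a_n)\neq 0$ for all finite collections $a_1,\dots,a_n\in J$ and all $0\neq c\in J$. If $J$ is a subalgebra of a Jordan algebra $Q$ and $q\in Q$, then $\mathcal D_J(q)$ is the set of $x\in J$ such that $U_xq$, $U_qx$ lie in $J$ and $U_qU_x\widehat J$, $U_xU_q\widehat J$, $V_{x,q}\widehat J$, $V_{q,x}\widehat J$ are contained in $J$ (it is an inner ideal of $J$). $Q$ is an algebra of quotients of $J$ if $\mathcal D_J(q)$ is a dense inner ideal of $J$ for all $q\in Q$ and $U_q\mathcal D_J(q)\neq0$ for all $0\ne q\in Q$. An algebra of quotients $Q$ of $J$ is maximal if for every algebra of quotients $Q'$ of $J$ there is a homomorphism $Q'\to Q$ restricting to the identity on $J$. Every nondegenerate Jordan algebra $J$ has a maximal algebra of quotients, unique up to isomorphism over $J$, denoted $Q_{max}(J)$. *)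

(* Defs.v *)
From HB Require Import structures.
From mathcomp Require Import all_boot all_order all_algebra.
From mathcomp Require Import finmap.
From mathcomp.classical Require Import boolp classical_sets.
From mathcomp.multinomials Require Import monalg.

Set Implicit Arguments.
Unset Strict Implicit.
Unset Printing Implicit Defensive.

Import GRing.Theory.
Local Open Scope classical_set_scope.
Local Open Scope ring_scope.

(** * Quadratic Jordan algebras *)

Section RawOperations.
Variables (R : comNzRingType) (J : lmodType R).
Variables (U : J -> J -> J) (sq : J -> J).

(* [tripleOf x y z] is {x, y, z} = U_{x,z} y = V_{x,y} z. *)
Definition tripleOf (x y z : J) : J := U (x + z) y - U x y - U z y.

Definition circOf (x y : J) : J := sq (x + y) - sq x - sq y.

(* The pair (a, x) stands for a 1 + x in the hull R 1 + J, on which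
   U_(a1+x) (b1+y) = a^2 b 1 + (a^2 y + a x o y + 2ab x + b x^2 + U_x y). *)
Definition hull : lmodType R := (R^o * J)%type.

Definition hullU (p q : hull) : hull :=
  (p.1 ^+ 2 * q.1,
   p.1 ^+ 2 *: q.2 + p.1 *: circOf p.2 q.2 + (p.1 * q.1) *: (p.2 *+ 2)
     + q.1 *: sq p.2 + U p.2 q.2).

End RawOperations.

(* The identities V_{x,y} U_x = U_x V_{y,x} and U_{U_x y} = U_x U_y U_x are
   required strictly, i.e. in all scalar extensions, or equivalently together
   with all their partial linearizations.  The components of degree (2,1) of
   the first, and (3,1) and (2,2) of the second, imply the remaining ones. *)
Record unital_jordan_axioms (R : comNzRingType) (J : lmodType R)
    (U : J -> J -> J) (e : J) : Prop := UnitalJordanAxioms {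
  uj_linear : forall x, linear (U x);
  uj_quadratic : forall a x y, U (a *: x) y = a ^+ 2 *: U x y;
  uj_bilinear : forall y z, linear (fun x => tripleOf U x y z);
  uj_unit : forall y, U e y = y;
  uj_shift : forall x y w, tripleOf U x y (U x w) = U x (tripleOf U y x w);
  uj_shift_21 : forall x z y w,
    tripleOf U z y (U x w) + tripleOf U x y (tripleOf U x w z)
    = tripleOf U x (tripleOf U y x w) z + U x (tripleOf U y z w);
  uj_fundamental : forall x y w, U (U x y) w = U x (U y (U x w));
  uj_fundamental_31 : forall x z y w,
    tripleOf U (U x y) w (tripleOf U x y z)
    = U x (U y (tripleOf U x w z)) + tripleOf U x (U y (U x w)) z;
  uj_fundamental_22 : forall x z y w,
    tripleOf U (U x y) w (U z y) + U (tripleOf U x y z) w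
    = U x (U y (U z w)) + U z (U y (U x w))
      + tripleOf U x (U y (tripleOf U x w z)) z
}.

(* A not necessarily unital J is Jordan when its free unital hull is a unital
   Jordan algebra; in particular this makes U and the square of J quadratic. *)
HB.mixin Record isJordan (R : comNzRingType) J of GRing.Lmodule R J := {
  jU : J -> J -> J;
  jsq : J -> J;
  jhull_axioms :
    unital_jordan_axioms (@hullU R J jU jsq) (1, 0)
}.

#[short(type="jordanType")]
HB.structure Definition Jordan (R : comNzRingType) :=
  {J of isJordan R J & GRing.Lmodule R J}.

Definition jcirc (R : comNzRingType) (J : jordanType R) (x y : J) : J :=
  circOf (@jsq R J) x y.

Definition hU (R : comNzRingType) (J : jordanType R) (p q : hull J) : hull J :=
  hullU (@jU R J) (@jsq R J) p q.

Definition hV (R : comNzRingType) (J : jordanType R) (p q r : hull J) : hull J :=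
  tripleOf (@hU R J) p q r.

Definition inhull (R : comNzRingType) (J : jordanType R) (x : J) : hull J :=
  (0, x).

Definition is_jordan_hom (R : comNzRingType) (J Q : jordanType R)
    (f : J -> Q) : Prop :=
  [/\ linear f,
      forall x y, f (jU x y) = jU (f x) (f y)
    & forall x, f (jsq x) = jsq (f x)].

(** * Inner ideals and nonsingularity *)

Section InnerIdeals.
Variables (R : comNzRingType) (J : jordanType R).

Definition is_submodule (K : set J) : Prop :=
  [/\ K 0, forall x y, K x -> K y -> K (x + y)
    & forall a x, K x -> K (a *: x)].

Definition inner_ideal (K : set J) : Prop :=
  is_submodule K /\
  forall k, K k -> forall z : hull J, (@inhull R J @` K) (hU (inhull k) z).

Definition essential (K : set J) : Prop :=
  inner_ideal K /\
  forall I : set J, inner_ideal I -> (exists2 x, I x & x != 0) ->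
    exists2 x, (K `&` I) x & x != 0.

Definition strongly_nonsingular : Prop :=
  forall K : set J, essential K ->
  forall a : J, (forall k, K k -> jU a k = 0) -> a = 0.

Definition von_neumann_regular : Prop :=
  forall a : J, exists y : J, jU a y = a.

Definition colon (K : set J) (a : J) : set J :=
  [set x | [/\ K x, K (jU a x) & K (jcirc x a)]].

(* (K : a_1 : ... : a_n) is [foldl colon K [:: a_1; ...; a_n]]. *)
Definition dense_inner_ideal (K : set J) : Prop :=
  inner_ideal K /\
  forall (s : seq J) (c : J), c != 0 ->
    exists2 x, foldl colon K s x & jU c x != 0.

End InnerIdeals.

(** * Algebras of quotients *)

(* "J is a subalgebra of Q" is an injective homomorphism [i : J -> Q]. *)
Section Quotients.
Variables (R : comNzRingType) (J : jordanType R).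

Definition hull_map (Q : jordanType R) (i : J -> Q) (z : hull J) : hull Q :=
  (z.1, i z.2).

Definition denominators (Q : jordanType R) (i : J -> Q) (q : Q) : set J :=
  [set x | let X := inhull (i x) in
           let q' := inhull q in
           let JinQhull : set (hull Q) := @inhull R Q @` range i in
    [/\ range i (jU (i x) q),
        range i (jU q (i x))
      & forall z : hull J,
        [/\ JinQhull (hU q' (hU X (hull_map i z))),
            JinQhull (hU X (hU q' (hull_map i z))),
            JinQhull (hV X q' (hull_map i z))
          & JinQhull (hV q' X (hull_map i z))]]].

Definition algebra_of_quotients (Q : jordanType R) (i : J -> Q) : Prop :=
  [/\ is_jordan_hom i, injective i,
      forall q : Q, dense_inner_ideal (denominators i q)
    & forall q : Q, q != 0 ->
        exists2 x, denominators i q x & jU q (i x) != 0].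

Definition maximal_algebra_of_quotients (Q : jordanType R) (i : J -> Q) : Prop :=
  algebra_of_quotients i /\
  forall (Q' : jordanType R) (i' : J -> Q'), algebra_of_quotients i' ->
    exists2 f : Q' -> Q, is_jordan_hom f & forall x, f (i' x) = i x.

End Quotients.

(** * The Jordan algebra of symmetric elements of an algebra with involution *)

Record involution (R : comNzRingType) (D : algType R) := Involution {
  inv_fun :> D -> D;
  inv_linear : linear inv_fun;
  inv_antimul : forall x y, inv_fun (x * y) = inv_fun y * inv_fun x;
  invK : involutive inv_fun
}.

Section SpecialAxioms.
Variables (R : comNzRingType) (V : lmodType R) (A : algType R).
Variables (phi : {linear V -> A}) (U : V -> V -> V) (e : V).
Hypothesis phi_inj : injective phi.
Hypothesis phiU : forall x y, phi (U x y) = phi x * phi y * phi x.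
Hypothesis phie : phi e = 1.

Let phiT x y z :
  phi (tripleOf U x y z) = phi x * phi y * phi z + phi z * phi y * phi x.
Proof.
rewrite /tripleOf !raddfB /= !phiU raddfD !(mulrDl, mulrDr) !addrA.
by rewrite [X in X - _]addrAC addrK -(addrA (phi x * _ * _)) addrC addKr addrC.
Qed.

Lemma special_unital_jordan : unital_jordan_axioms U e.
Proof.
split.
- move=> x a y z; apply: phi_inj.
  by rewrite linearP /= !phiU linearP /= mulrDr mulrDl -scalerAr -scalerAl.
- move=> a x y; apply: phi_inj; rewrite linearZ /= !phiU linearZ /=.
  by rewrite -!scalerAl -scalerAr scalerA expr2.
- move=> y z a u v; apply: phi_inj; rewrite linearP /= !phiT linearP /=.
  rewrite !(mulrDl, mulrDr) scalerDr -!scalerAl -!scalerAr -!addrA.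
  by congr (_ + _); rewrite addrCA.
- by move=> y; apply: phi_inj; rewrite phiU phie mul1r mulr1.
- move=> x y w; apply: phi_inj; rewrite phiT !phiU phiT.
  by rewrite !(mulrDl, mulrDr) !mulrA.
- move=> x z y w; apply: phi_inj; move: (tripleOf U) phiT => T phiT'.
  rewrite !raddfD /= !(phiT', phiU).
  by rewrite !(mulrDl, mulrDr) !mulrA !addrA [LHS](ACl (3 * 2 * 1 * 6 * 4 * 5)).
- by move=> x y w; apply: phi_inj; rewrite !phiU !mulrA.
- move=> x z y w; apply: phi_inj; move: (tripleOf U) phiT => T phiT'.
  rewrite !raddfD /= !(phiT', phiU).
  by rewrite !(mulrDl, mulrDr) !mulrA !addrA [LHS](ACl (2 * 3 * 1 * 4)).
- move=> x z y w; apply: phi_inj; move: (tripleOf U) phiT => T phiT'.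
  rewrite !raddfD /= !(phiT', phiU).
  by rewrite !(mulrDl, mulrDr) !mulrA !addrA [LHS](ACl (5 * 4 * 1 * 3 * 6 * 2)).
Qed.

End SpecialAxioms.


Section Hermitian.
Variables (R : comNzRingType) (D : algType R) (s : involution D).

Definition symmetric_pred : {pred D} := [pred x | s x == x].

Fact symmetric_submod_closed : submod_closed symmetric_pred.
Proof.
split=> [|a x y]; rewrite !inE.
  by have := inv_linear s (-1) 0 0; rewrite scaler0 addr0 scaleN1r addNr => ->.
by move=> /eqP sx /eqP sy; rewrite inv_linear sx sy.
Qed.

HB.instance Definition _ :=
  GRing.isSubmodClosed.Build R D symmetric_pred symmetric_submod_closed.

(* H(D, s) *)
Record hermitian := Hermitian { hval : D; hvalP : hval \in symmetric_pred }.

HB.instance Definition _ := [isSub for hval].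
HB.instance Definition _ := [Choice of hermitian by <:].
HB.instance Definition _ := [SubChoice_isSubLmodule of hermitian by <:].

Fact hermitian_U_subproof (x y : hermitian) :
  hval x * hval y * hval x \in symmetric_pred.
Proof.
case: x y => [x /eqP sx] [y /eqP sy] /=.
by rewrite inE !inv_antimul sx sy mulrA.
Qed.

Fact hermitian_sq_subproof (x : hermitian) :
  hval x * hval x \in symmetric_pred.
Proof. by case: x => [x /eqP sx] /=; rewrite inE inv_antimul sx. Qed.

Definition hermitian_U (x y : hermitian) : hermitian :=
  Hermitian (hermitian_U_subproof x y).

Definition hermitian_sq (x : hermitian) : hermitian :=
  Hermitian (hermitian_sq_subproof x).

Let shift_U (a b : R) (x y : D) :
  (a ^+ 2 * b)%:A + (a ^+ 2 *: y
    + a *: ((x + y) * (x + y) - x * x - y * y)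
    + (a * b) *: (x + x) + b *: (x * x) + x * y * x)
  = (a%:A + x) * (b%:A + y) * (a%:A + x).
Proof.
have -> : (x + y) * (x + y) - x * x - y * y = x * y + y * x.
  rewrite !(mulrDl, mulrDr) !addrA.
  by rewrite [LHS]addrAC addrK -(addrA (x * x)) [LHS]addrC addKr.
rewrite !(mulrDl, mulrDr, scalerDr).
rewrite -!(scalerAl, scalerAr) !scalerA !(mul1r, mulr1) !addrA.
rewrite expr2.
by rewrite [LHS](ACl (1 * 2 * 5 * 3 * 6 * 4 * 7 * 8)) -(mulrA a a b).
Qed.

(* Embeds the hull of H(D, s) in the unital associative algebra R x D. *)
Let phi (p : hull hermitian) : (R^o * D)%type := (p.1, p.1 *: 1 + val p.2).

Let phi_linear : linear phi.
Proof.
move=> a [b x] [c y]; rewrite /phi; congr (_, _) => /=.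
rewrite scalerDl scalerDr scalerA.
by rewrite !addrA; congr (_ + _); rewrite addrAC.
Qed.

HB.instance Definition _ :=
  GRing.isLinear.Build R (hull hermitian) (R^o * D)%type _ phi phi_linear.

Fact hermitian_hull_axioms :
  unital_jordan_axioms (hullU hermitian_U hermitian_sq) (1, 0).
Proof.
apply: (@special_unital_jordan R _ (R^o * D)%type phi) => /=.
- move=> [a x] [b y] [<-] /addrI /val_inj -> //.
- move=> [a x] [b y]; congr (_, _); rewrite /=.
    by rewrite expr2 mulrAC.
  exact: shift_U.
- by rewrite /phi /= scale1r addr0.
Qed.

HB.instance Definition _ :=
  isJordan.Build R hermitian hermitian_hull_axioms.

End Hermitian.

(** * The free associative algebra on two generators *)

Section FreeAlgebra.
Variable R : comNzRingType.

(* Unital; {fmonom 'I_2} is the free monoid, of words on two letters. *)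
Definition Ass2 : Type := {malg R[{fmonom 'I_2}]}.

HB.instance Definition _ := GRing.Lalgebra.on Ass2.

Definition rev_word (m : {fmonom 'I_2}) : {fmonom 'I_2} := FMonom (rev m).

Definition std_inv_fun (g : Ass2) : Ass2 :=
  \sum_(m <- msupp g) << g@_m *g rev_word m >>.

Lemma rev_wordK : involutive rev_word.
Proof. by case=> m; rewrite /rev_word /= revK. Qed.

Lemma rev_wordM m n : rev_word (mmul m n) = mmul (rev_word n) (rev_word m).
Proof. by apply/eqP; rewrite fmP fmM /= !fmM rev_cat. Qed.

Lemma mcoeff_std_inv (g : Ass2) m : (std_inv_fun g)@_m = g@_(rev_word m).
Proof.
rewrite raddf_sum /=.
under eq_bigr => k _ do rewrite mcoeffU (can2_eq rev_wordK rev_wordK).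
case: (boolP (rev_word m \in msupp g)) => gm.
  rewrite (big_fsetD1 _ gm) /= eqxx big_seq big1 ?addr0 // => k.
  by rewrite in_fsetD1 => /andP[/negPf -> _].
rewrite (mcoeff_outdom gm) big_seq big1 // => k gk.
by case: eqP gk => // ->; rewrite (negPf gm).
Qed.

Fact std_inv_is_linear : linear std_inv_fun.
Proof.
by move=> a x y; apply/malgP => m; rewrite !(mcoeff_std_inv, mcoeffD, mcoeffZ).
Qed.

Fact std_invK : involutive std_inv_fun.
Proof. by move=> x; apply/malgP => m; rewrite !mcoeff_std_inv rev_wordK. Qed.

HB.instance Definition _ :=
  GRing.isLinear.Build R Ass2 Ass2 _ std_inv_fun std_inv_is_linear.

Lemma std_invU c m : std_inv_fun << c *g m >> = << c *g rev_word m >>.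
Proof.
by apply/malgP => n; rewrite mcoeff_std_inv !mcoeffU (can2_eq rev_wordK rev_wordK).
Qed.

Fact std_invM (x y : Ass2) :
  std_inv_fun (x * y) = std_inv_fun y * std_inv_fun x.
Proof.
rewrite malgME raddf_sum mulr_sumr; apply: eq_bigr => m _.
rewrite raddf_sum mulr_suml; apply: eq_bigr => n _ /=.
by rewrite std_invU rev_wordM malgM_def fgmulUU mulrC.
Qed.

Fact Ass2_scalerAr (a : R) (x y : Ass2) : a *: (x * y) = x * (a *: y).
Proof.
apply/malgP => k; rewrite mcoeffZ (mcoeffMl x y) /=.
rewrite (@mcoeffMlw _ _ (msupp x) (msupp y)) ?msuppZ_le // mulr_sumr.
apply: eq_bigr => m _; rewrite mulr_sumr; apply: eq_bigr => n _.
by rewrite mcoeffZ mulrCA mulrnAr.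
Qed.

HB.instance Definition _ := GRing.Lalgebra_isAlgebra.Build R Ass2 Ass2_scalerAr.

Definition std_inv : involution Ass2 :=
  Involution std_inv_is_linear std_invM std_invK.

(* The generators X (i = 0) and Y (i = 1). *)
Definition Ass2_gen (i : 'I_2) : Ass2 := << fmu i >>.

Lemma std_inv_gen (i : 'I_2) : std_inv (Ass2_gen i) = Ass2_gen i.
Proof. by rewrite /= std_invU; congr << _ >>; rewrite fmuE. Qed.

End FreeAlgebra.

Definition sym_Ass2 (R : comNzRingType) : jordanType R :=
  hermitian (std_inv R).

(* Main.v *)
Require Import Defs.
From mathcomp Require Import all_boot all_order all_algebra.
From mathcomp Require Import finmap.
From mathcomp.classical Require Import classical_sets.
From mathcomp.multinomials Require Import monalg.

Set Implicit Arguments.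
Unset Strict Implicit.
Unset Printing Implicit Defensive.

Import GRing.Theory.
Local Open Scope ring_scope.

(** The free algebra D = Ass[X,Y] over a domain has no zero divisors, so
    a b a = 0 in J = H(D, star) forces a = 0 or b = 0.  An essential inner
    ideal is nonzero, hence J is strongly nonsingular.

    For the second half, every algebra of quotients Q of J fails to be
    regular at X.  Morally, a y in Q with U_X y = X must be X^-1; a denominator
    k of y would then give p = kX^-1 + X^-1 k in D, so that XpX = Xk + kX, and
    comparing first and last letters confines k to words that are short or
    begin and end with X.  But the denominators of y are dense, so they
    contain some nonzero k = YmY: a contradiction.

    To run this inside an abstract Jordan algebra Q, two facts are needed.
    - Every nonzero b in J acts on Q by an injective U_b
      ([quotient_U_inj]): for a denominator m = U_b m0 of q, the equation
      U_b q = 0 makes U_m U_q vanish on J, and then U_q x = 0 for every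
      denominator x of q because J has no zero divisors.  Consequently
      U_b y = b makes U_b and U_y inverse to each other
      ([regular_inverse]), so that y behaves as b^-1.
    - For such y, the quadratic Jordan identities give
      U_b U_b (k o y) = {b, k, b^2} ([inverse_circ]).  When k is a denominator
      of y, the element p = k o y lies in J and this is an equation in J
      ([regular_fraction]).

    For b = X and k = YmY that equation reads
    X^2 p X^2 = X k X^2 + X^2 k X in D, which the coefficients of the words
    X X ... Y X refute ([XkXX_XXkX_notin_XXDXX]). *)

(** * The free associative algebra on X and Y *)

Section FreeAlgebra.
Variable R : idomainType.
Implicit Types (f g p : Ass2 R) (w : seq 'I_2) (i j : 'I_2).

Lemma longest_word f : f != 0 ->
  exists2 u, f@_u != 0 & forall v, f@_v != 0 -> (size v <= size u)%N.
Proof.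
move=> f0; have [u0 fu0] : exists u, u \in msupp f.
  by apply/fset0Pn; rewrite msupp_eq0.
case: (@arg_maxnP (msupp f) [` fu0]%fset predT (fun u => size (val u))) => //.
move=> u _ umax; exists (val u); first by rewrite mcoeff_neq0 (valP u).
by move=> v; rewrite mcoeff_neq0 => fv; apply: (umax [` fv]%fset).
Qed.

(** The concatenation of two longest words of f and g arises in only one way
    from words of f and g, since the lengths force the cut; hence its
    coefficient in f g is a product of two nonzero scalars. *)
Lemma Ass2_integral f g : f * g = 0 -> f = 0 \/ g = 0.
Proof.
move=> fg0; case: (eqVneq f 0) => [|f0]; first by left.
case: (eqVneq g 0) => [|g0]; first by right.
have [u fu umax] := longest_word f0.
have [v gv vmax] := longest_word g0.
suff : (f * g)@_(mmul u v) = f@_u * g@_v.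
  by rewrite fg0 mcoeff0 => /esym/eqP; rewrite mulf_eq0 (negPf fu) (negPf gv).
rewrite mcoeffMl (big_fsetD1 u) /=; last by rewrite -mcoeff_neq0.
rewrite (big_fsetD1 v) /=; last by rewrite -mcoeff_neq0.
rewrite eqxx mulr1n [X in _ + X + _]big_seq big1 ?addr0 => [|n]; last first.
  rewrite in_fsetD1 => /andP[nv _]; rewrite fmP !fmM eqseq_cat // eqxx.
  by rewrite -fmP (negPf nv).
rewrite big_seq big1 ?addr0 // => m; rewrite in_fsetD1 => /andP[mu fm].
rewrite big_seq big1 // => n gn; case: eqP => // /eqP; rewrite fmP !fmM => mn.
have := umax m; have := vmax n.
rewrite !mcoeff_neq0 => /(_ gn) szn /(_ fm) szm.
have eqs : size m = size u.
  have /eqP := congr1 size (eqP mn); rewrite !size_cat => szmn.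
  apply/eqP; rewrite eqn_leq szm /= -(leq_add2r (size v)) -(eqP szmn).
  by rewrite leq_add2l.
by move: mn; rewrite eqseq_cat // -fmP (negPf mu).
Qed.

Lemma mcoeff_mul_gen f i w j :
  (f * Ass2_gen R i)@_(FMonom (rcons w j)) = f@_(FMonom w) *+ (i == j).
Proof.
rewrite (@mcoeffMrw _ _ (msupp f) [fset fmu i]%fset) ?msuppU_le //.
rewrite big_seq_fset1 mcoeffUU.
have E m : (mmul m (fmu i) == FMonom (rcons w j)) = (m == FMonom w) && (i == j).
  by rewrite fmP fmM fmuE /= cats1 eqseq_rcons fmP.
under eq_bigr => m _ do rewrite mulr1 E.
case: (boolP (FMonom w \in msupp f)) => fw.
  rewrite (big_fsetD1 (FMonom w)) //= eqxx big_seq big1 ?addr0 // => m.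
  by rewrite in_fsetD1 => /andP[/negPf -> _].
rewrite (mcoeff_outdom fw) mul0rn big_seq big1 // => m fm.
by case: eqP fm => //= ->; rewrite (negPf fw).
Qed.

Lemma mcoeff_gen_mul f i w j :
  (Ass2_gen R i * f)@_(FMonom (j :: w)) = f@_(FMonom w) *+ (i == j).
Proof.
have -> : Ass2_gen R i * f = std_inv_fun (std_inv_fun f * Ass2_gen R i).
  have {1}<- : std_inv_fun (Ass2_gen R i) = Ass2_gen R i := std_inv_gen R i.
  by rewrite std_invM !std_invK.
rewrite mcoeff_std_inv /rev_word /= rev_cons mcoeff_mul_gen.
by rewrite mcoeff_std_inv /rev_word /= revK.
Qed.

(** With k = fY, the words of X^2 k X end in YX, whereas those of the two other
    terms end in XX. *)
Lemma XkXX_XXkX_notin_XXDXX f p (X := Ass2_gen R 0) (Y := Ass2_gen R 1) :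
  f != 0 ->
  X * (X * p * X) * X <> X * (f * Y) * (X * X) + X * X * (f * Y) * X.
Proof.
have XL g w : (X * g)@_(FMonom (0 :: w)) = g@_(FMonom w).
  by rewrite mcoeff_gen_mul eqxx.
have XR g w : (g * X)@_(FMonom (rcons w 0)) = g@_(FMonom w).
  by rewrite mcoeff_mul_gen eqxx.
have XR0 g w : (g * X)@_(FMonom (rcons w 1)) = 0 by rewrite mcoeff_mul_gen.
have YR g w : (g * Y)@_(FMonom (rcons w 1)) = g@_(FMonom w).
  by rewrite mcoeff_mul_gen eqxx.
(* The word is XX v YX for any word v of f. *)
case/longest_word => -[v] fv _.
move/malgP/(_ (FMonom (rcons [:: 0, 0 & rcons v 1] 0))).
(* Only the four coefficient rules above matter from here on. *)
move: X Y XL XR XR0 YR => X Y XL XR XR0 YR.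
have E1 : (X * (X * p * X) * X)@_(FMonom (rcons [:: 0, 0 & rcons v 1] 0)) = 0.
  by rewrite XR XL -rcons_cons XR0.
have E2 : (X * (f * Y) * (X * X))@_(FMonom (rcons [:: 0, 0 & rcons v 1] 0)) = 0.
  by rewrite mulrA XR -!rcons_cons XR0.
have E3 : (X * X * (f * Y) * X)@_(FMonom (rcons [:: 0, 0 & rcons v 1] 0)) =
  f@_(FMonom v).
  apply: etrans (XR _ _) _; rewrite -(mulrA X X).
  by apply: etrans (XL _ _) _; apply: etrans (XL _ _) _; apply: YR.
move/(etrans (esym E1)); rewrite mcoeffD.
by move/esym/(etrans (esym (congr2 _ E2 E3))); rewrite add0r => /eqP;
  apply/negP.
Qed.

End FreeAlgebra.

(** * Identities in unital quadratic Jordan algebras *)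

Section UnitalJordan.
Variables (R : comNzRingType) (H : lmodType R) (U : H -> H -> H) (e : H).
Hypothesis ax : unital_jordan_axioms U e.
Local Notation T := (tripleOf U).

Lemma tripleC x y z : T x y z = T z y x.
Proof. by rewrite /tripleOf (addrC x) addrAC. Qed.

(** Both sides are y o w, so that the circle product with y may be read as
    V_{1,y} or as V_{y,1}. *)
Lemma triple_unit y w : T e y w = T y e w.
Proof. by have := uj_shift ax e y w; rewrite !(uj_unit ax). Qed.

(** The fundamental formula linearized in its inner variable, that is,
    U_x U_{y,z} U_x = U_{U_x y, U_x z}. *)
Lemma fundamental_triple x y z w : U x (T y (U x w) z) = T (U x y) w (U x z).
Proof.
have D u v : U x (u + v) = U x u + U x v.
  by have := uj_linear ax x 1 u v; rewrite !scale1r.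
have U0 : U x 0 = 0 by apply: (addrI (U x 0)); rewrite -D !addr0.
have N u : U x (- u) = - U x u.
  by apply: (addrI (U x u)); rewrite -D !subrr.
by rewrite /tripleOf -(D y z) !(uj_fundamental ax) !D !N.
Qed.

(** As U_x U_y = 1, writing k = U_y w with w = U_x k turns
    U_x (k o y) = U_x U_y (y o w) into y o U_x k, and the linearized fundamental
    formula evaluates U_x on the latter; in an associative algebra this is
    x^2 (ky + yk) x^2 = x k x^2 + x^2 k x for y = x^-1.  Invertibility enters
    only through its consequences at the elements involved, since U_x and U_y
    will be mutually inverse on an algebra of quotients Q but not on the hull
    of Q. *)
Lemma inverse_circ x y k :
    U x y = x -> U y (U x k) = k ->
    U x (U y (T e y (U x k))) = T e y (U x k) ->
  U x (U x (T k y e)) = T x k (U x e).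
Proof.
move=> xyx yxk xyK; have -> : T k y e = U y (T e y (U x k)).
  by rewrite -(uj_shift ax) yxk -triple_unit tripleC.
by rewrite xyK triple_unit tripleC -triple_unit tripleC fundamental_triple xyx.
Qed.

End UnitalJordan.

(** * Jordan algebras inside their unital hulls *)

Section JordanHull.
Variables (R : comNzRingType) (J : jordanType R).
Implicit Types x y z w : J.
Let ax : unital_jordan_axioms (@hU R J) (1, 0) := jhull_axioms.

Lemma inhull_inj : injective (@inhull R J).
Proof. by move=> x y []. Qed.

Lemma inhullB x y : inhull (x - y) = inhull x - inhull y.
Proof. by congr (_, _); rewrite /= subrr. Qed.

Lemma inhullD x y : inhull (x + y) = inhull x + inhull y.
Proof. by congr (_, _); rewrite /= addr0. Qed.

Lemma hU_inhull x y : hU (inhull x) (inhull y) = inhull (jU x y).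
Proof.
by rewrite /hU /hullU /inhull /= expr2 !mul0r !scale0r !add0r.
Qed.

Lemma hV_inhull x y z :
  hV (inhull x) (inhull y) (inhull z) = inhull (tripleOf (@jU R J) x y z).
Proof. by rewrite /hV /tripleOf -inhullD !hU_inhull !inhullB. Qed.

Lemma jUD x y z : jU x (y + z) = jU x y + jU x z.
Proof.
apply: inhull_inj; rewrite inhullD -!hU_inhull inhullD.
by have := uj_linear ax (inhull x) 1 (inhull y) (inhull z); rewrite !scale1r.
Qed.

Lemma jU0 x : jU x 0 = 0.
Proof. by apply: (addrI (jU x 0)); rewrite -jUD !addr0. Qed.

Lemma jUB x y z : jU x (y - z) = jU x y - jU x z.
Proof. by apply: (addIr (jU x z)); rewrite -jUD !subrK. Qed.

Lemma jU0l y : jU 0 y = 0.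
Proof.
apply: inhull_inj; rewrite -hU_inhull.
have := uj_quadratic ax 0 (inhull 0) (inhull y).
by rewrite expr2 mul0r !scale0r.
Qed.

Lemma jU_fundamental x y w : jU (jU x y) w = jU x (jU y (jU x w)).
Proof. by apply: inhull_inj; rewrite -!hU_inhull (uj_fundamental ax). Qed.

Lemma hU_unit x : hU (inhull x) (1, 0) = inhull (jsq x).
Proof.
by rewrite /hU /hullU /inhull /= jU0 expr2 !mul0r !scale0r !add0r scale1r addr0.
Qed.

Lemma hU_inhull_range x (p : hull J) : exists z, hU (inhull x) p = inhull z.
Proof. by eexists; congr (_, _); rewrite /= expr2 !mul0r. Qed.

Lemma hV_unit_inhull x y : exists z, hV (1, 0) (inhull x) (inhull y) = inhull z.
Proof.
rewrite /hV /tripleOf /hU /hullU; eexists; congr (_, _).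
by rewrite /= !mulr0 !subr0.
Qed.

End JordanHull.

(** * Algebras of quotients of a Jordan algebra without zero divisors *)

Section Quotient.
Variables (R : comNzRingType) (J Q : jordanType R) (i : J -> Q).
Hypothesis J_domain : forall a b : J, jU a b = 0 -> a = 0 \/ b = 0.
Hypothesis iQ : algebra_of_quotients i.

Let i_inj : injective i. Proof. by case: iQ. Qed.

Let iD x y : i (x + y) = i x + i y.
Proof.
by case: iQ => -[lin _ _] _ _ _; have := lin 1 x y; rewrite !scale1r.
Qed.

Let i0 : i 0 = 0.
Proof. by apply: (addrI (i 0)); rewrite -iD !addr0. Qed.

Let iB x y : i (x - y) = i x - i y.
Proof. by apply: (addIr (i y)); rewrite -iD !subrK. Qed.

Let iU x y : i (jU x y) = jU (i x) (i y).
Proof. by case: iQ => -[_]. Qed.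

Let hull_map_inhull x : hull_map i (inhull x) = inhull (i x).
Proof. by []. Qed.

(** Density at the single element b: any m in (K : b), with K the denominators
    of q, has U_b m in K. *)
Lemma denominators_colon (q : Q) (b : J) : b != 0 ->
  exists2 m, m != 0 & denominators i q (jU b m).
Proof.
case: iQ => _ _ /(_ q)[_ dense] _ b0.
have [m [_ Kbm _] bm0] := dense [:: b] b b0.
by exists m => //; apply: contra_neq bm0 => ->; rewrite jU0.
Qed.

(** Take a denominator m = U_b m0 of q.  For c in J, the element
    d = U_m U_q c of J satisfies U_d = U_m U_q U_c U_q U_m, and U_q U_m is zero
    on J because U_b U_q U_b = 0 and U_b is injective on J; so d = 0.
    Applied to the denominators c = x of q, for which U_q x lies in J, this gives
    U_q x = 0, and a nonzero element of an algebra of quotients cannot do so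
    at all its denominators. *)
Lemma quotient_U_inj (b : J) (q : Q) : b != 0 -> jU (i b) q = 0 -> q = 0.
Proof.
move=> b0 bq0; case: (eqVneq q 0) => // q0.
have [m0 m00 Km] := denominators_colon q b0.
set m := jU b m0 in Km.
have m_neq0 : m != 0.
  by apply/eqP => /J_domain[] /eqP; rewrite (negPf b0, negPf m00).
have mq0 c : jU (i m) (jU q (i c)) = 0.
  case: Km => _ _ Km; have [_ [_ [d _ <-] idE] _ _] := Km (inhull c).
  move: idE; rewrite hull_map_inhull !hU_inhull => /inhull_inj idE.
  rewrite -idE; suff /J_domain[] : jU d b = 0; first by move=> ->.
    by move/eqP; rewrite (negPf b0).
  apply: i_inj; rewrite iU i0 idE !jU_fundamental -!iU -/m.
  have [[_ [g _ <-] gE] _ _ _] := Km (inhull b).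
  move: gE; rewrite hull_map_inhull !hU_inhull -iU => /inhull_inj gE.
  suff g0 : g = 0 by rewrite -gE g0 i0 !jU0.
  suff /J_domain[/eqP|] : jU b g = 0 by rewrite ?(negPf b0).
  apply: i_inj; rewrite iU gE iU /m /= !iU jU_fundamental -jU_fundamental bq0.
  by rewrite jU0l i0.
case: iQ => _ _ _ /(_ q q0)[x [_ [h _ hE] _]]; rewrite -hE => /eqP[].
suff /J_domain[/eqP|->] : jU m h = 0 by rewrite ?(negPf m_neq0).
by apply: i_inj; rewrite iU hE mq0 i0.
Qed.

(** U_b U_y U_b = U_b gives U_y U_b = 1 by cancelling U_b; then b = U_y U_b b
    gives U_b = U_y U_b U_b U_b U_y = U_b U_b U_y, and U_b cancels again. *)
Lemma regular_inverse (b : J) (y : Q) : b != 0 -> jU (i b) y = i b ->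
  cancel (jU (i b)) (jU y) /\ cancel (jU y) (jU (i b)).
Proof.
move=> b0 byb; have bI q1 q2 : jU (i b) q1 = jU (i b) q2 -> q1 = q2.
  move=> q12; apply/eqP; rewrite -subr_eq0; apply/eqP/(quotient_U_inj b0).
  by rewrite jUB q12 subrr.
have ybK : cancel (jU (i b)) (jU y).
  by move=> q; apply: bI; rewrite -jU_fundamental byb.
split=> // q; apply: (bI).
by rewrite -[in RHS](ybK (i b)) !jU_fundamental ybK.
Qed.

(** The witness p is k o y, which lies in J because V_{k,y} maps the unit of the
    hull into J. *)
Lemma regular_fraction (b k : J) (y : Q) :
    b != 0 -> jU (i b) y = i b -> denominators i y k ->
  exists p, jU b (jU b p) = tripleOf (@jU R J) b k (jsq b).
Proof.
move=> b0 byb [_ _ /(_ (1, 0))[_ _ [_ [p _ <-] pE] _]].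
move: pE; rewrite /hull_map /= i0 => pE.
have [ybK byK] := regular_inverse b0 byb.
exists p; apply: i_inj; apply: inhull_inj.
have iT x z w :
    i (tripleOf (@jU R J) x z w) = tripleOf (@jU R Q) (i x) (i z) (i w).
  by rewrite /tripleOf -iD -!iU !iB.
have isq x : i (jsq x) = jsq (i x) by case: iQ => -[].
rewrite !iU iT isq -!hU_inhull pE -hV_inhull -hU_unit.
apply: (inverse_circ jhull_axioms); rewrite -?/(hU _ _) ?hU_inhull ?byb ?ybK //.
have [z] := hV_unit_inhull y (jU (i b) (i k)).
by rewrite /hV => ->; rewrite !hU_inhull byK.
Qed.

End Quotient.

(** * Symmetric elements *)

Section Hermitian.
Variables (R : comNzRingType) (D : algType R) (s : involution D).
Local Notation J := (Defs.hermitian s).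

Lemma hval_triple (x y z : J) :
  hval (tripleOf (@jU _ J) x y z) =
  hval x * hval y * hval z + hval z * hval y * hval x.
Proof.
have hB (u v : J) : hval (u - v) = hval u - hval v := raddfB val u v.
have hD (u v : J) : hval (u + v) = hval u + hval v := raddfD val u v.
have hUE (u v : J) : hval (jU u v) = hval u * hval v * hval u by [].
rewrite /tripleOf !hB !hUE hD !(mulrDl, mulrDr).
move: (_ * _ * _) (_ * _ * _) (_ * _ * _) (_ * _ * _) => a b c d.
by rewrite !addrA [LHS]addrAC addrK -(addrA d) [LHS]addrC addKr addrC.
Qed.

End Hermitian.

Section SymmetricElements.
Variable R : idomainType.
Local Notation J := (sym_Ass2 R).

Lemma sym_Ass2_domain (a b : J) : jU a b = 0 -> a = 0 \/ b = 0.
Proof.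
move=> /(congr1 (fun x : J => hval x)) ab0.
have H0 (x : J) : hval x = 0 -> x = 0 by move=> x0; apply: val_inj.
case: (Ass2_integral ab0) => [/Ass2_integral[]|] /H0; by [left | right].
Qed.

Fact sym_gen_subproof j : Ass2_gen R j \in symmetric_pred (std_inv R).
Proof. by rewrite inE std_inv_gen. Qed.

Definition sym_gen j : J := Defs.Hermitian (sym_gen_subproof j).

Lemma gen_neq0 j : Ass2_gen R j != 0.
Proof.
apply/eqP => /malgP/(_ (fmu j)); rewrite mcoeffUU mcoeff0.
by move/eqP; rewrite oner_eq0.
Qed.

Lemma sym_gen_neq0 j : sym_gen j != 0.
Proof.
by apply: contra_neq (gen_neq0 j) => /(congr1 (fun x : J => hval x)).
Qed.

Lemma sym_gen_triple_notin_UU (m p : J) : m != 0 ->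
  jU (sym_gen 0) (jU (sym_gen 0) p) <>
  tripleOf (@jU _ J) (sym_gen 0) (jU (sym_gen 1) m) (jsq (sym_gen 0)).
Proof.
move=> m0 /(congr1 (fun x : J => hval x)); rewrite (hval_triple (sym_gen 0)) /=.
apply: XkXX_XXkX_notin_XXDXX; apply/eqP => /Ass2_integral[] /eqP.
  by rewrite (negPf (gen_neq0 1)).
by apply/negP; apply: contra_neq m0 => m0; apply: val_inj.
Qed.

End SymmetricElements.

Theorem proposition3p2 (Phi : idomainType) :
  strongly_nonsingular (sym_Ass2 Phi) /\
  forall (Q : jordanType Phi) (i : sym_Ass2 Phi -> Q),
    maximal_algebra_of_quotients i -> ~ von_neumann_regular Q.
Proof.
split=> [K [_ Kess] a aK0 | Q i [iQ _] /(_ (i (sym_gen Phi 0)))[y yE]].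
  have [||x [Kx _] /negPf x0] := Kess setT.
  - by split=> // k _ z; have [w ->] := hU_inhull_range k z; exists w.
  - by exists (sym_gen Phi 0); rewrite ?sym_gen_neq0.
  by case: (sym_Ass2_domain (aK0 x Kx)) => // /eqP; rewrite x0.
have [m m0 Km] := denominators_colon iQ y (sym_gen_neq0 Phi 1).
have [p] :=
  regular_fraction (@sym_Ass2_domain Phi) iQ (sym_gen_neq0 Phi 0) yE Km.
exact: sym_gen_triple_notin_UU.
Qed.
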